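(* Let $p>5$ be a prime. Then \[\sum_{k=1}^{p-1}\binom{p}{k}^2\binom{p+k-1}{k-1}\equiv pH_{p-1}+\frac{9}{10}p^5B_{p-5}\pmod{p^6},\] \[\sum_{k=1}^{p-1}\binom{p}{k}^2\binom{p+k-1}{k-1}k\equiv -3p^2H_{p-1}+ \frac{21}{10}p^6B_{p-5}\pmod{p^7},\] and \[\sum_{k=1}^{p-1}\binom{p}{k}^2\binom{p+k-1}{k-1}k^2\equiv -p^2-(4p^5+4p^4+2p^3)H_{p-1}+\frac45p^7B_{p-5}\pmod{p^8}.\]
   Context: $H_{p-1}=\sum_{k=1}^{p-1}\frac1k$. Bernoulli numbers are defined by $B_0=1$ and $\sum_{k=0}^{n}\binom{n+1}{k}B_k=0$ for $n\ge1$. Congruences between rational numbers modulo $p^m$ are understood in the ring of rationals whose denominators are prime to $p$. *)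

(* Defs.v *)
From mathcomp Require Import all_boot all_order all_algebra.

Set Implicit Arguments.
Unset Strict Implicit.
Unset Printing Implicit Defensive.

Import Order.TTheory GRing.Theory Num.Theory.
Local Open Scope ring_scope.

(* The sequence [:: B_0; ...; B_n]. Each new entry is obtained by solving
   \sum_(k < m.+2) 'C(m.+2, k) B_k = 0 for B_{m+1}, whose coefficient is
   'C(m.+2, m.+1) = m.+2; see bernoulli_sum. *)
Fixpoint bernoulli_seq (n : nat) : seq rat :=
  if n is m.+1 then
    let s := bernoulli_seq m in
    rcons s (- (\sum_(k < m.+1) 'C(m.+2, k)%:R * s`_k) / m.+2%:R)
  else [:: 1].

Definition bernoulli (n : nat) : rat := (bernoulli_seq n)`_n.

Definition harmonic (n : nat) : rat := \sum_(1 <= k < n.+1) k%:R^-1.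

Definition p_integral (p : nat) (x : rat) : bool := coprime p `|denq x|%N.

(* Congruence modulo p^m in the ring of p-integral rationals: both sides are
   required to lie in that ring, and so is the quotient (x - y) / p^m. *)
Definition eqmodq (p m : nat) (x y : rat) : Prop :=
  [/\ p_integral p x, p_integral p y
    & exists2 z : rat, p_integral p z & x - y = p%:R ^+ m * z].

Lemma size_bernoulli_seq n : size (bernoulli_seq n) = n.+1.
Proof. by elim: n => //= n IHn; rewrite size_rcons IHn. Qed.

Lemma nth_bernoulli_seq n k : (k <= n)%N -> (bernoulli_seq n)`_k = bernoulli k.
Proof.
elim: n => [|n IHn]; first by rewrite leqn0 => /eqP ->.
rewrite leq_eqVlt => /predU1P[-> //|]; rewrite ltnS => le_kn.
by rewrite /= nth_rcons size_bernoulli_seq ltnS le_kn IHn.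
Qed.

Lemma bernoulli0 : bernoulli 0 = 1.
Proof. by []. Qed.

Lemma bernoulli_sum n :
  (1 <= n)%N -> \sum_(0 <= k < n.+1) 'C(n.+1, k)%:R * bernoulli k = 0.
Proof.
case: n => // n _; rewrite big_nat_recr //= big_mkord binSn.
rewrite [bernoulli n.+1]/bernoulli /= nth_rcons size_bernoulli_seq ltnn eqxx.
rewrite mulrC divfK ?pnatr_eq0 //; apply/eqP; rewrite subr_eq0; apply/eqP.
by apply: eq_bigr => k _; rewrite nth_bernoulli_seq // -ltnS.
Qed.

(* Main.v *)
Require Import Defs.
From HB Require Import structures.
From mathcomp Require Import all_boot all_order all_algebra.
From mathcomp Require Import ring zify.

Import Order.TTheory GRing.Theory Num.Theory.
Local Open Scope ring_scope.

(** Write [u_k] for the reciprocals of [1, ..., p-1] and [H_s] for their power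
    sums. The k-th summand is [p^2 u_k^2 a_k], where [a_k] is the product of
    [(1 - p u_j)^2 (1 + p u_j) = (1 - p u_j) (1 - p^2 u_j^2)] over [j < k].
    With [T_m = \sum_k a_k u_k^m], the three sums are [p^2 T_2], [p^2 T_1] and
    [p^2 T_0]; since [a_(k+1) / a_k] is a cubic polynomial in [u_k], telescoping
    expresses [T_0] and [T_1] through [T_2], [T_3] and [a_p].

    Dropping the factors [1 - p^2 u_j^2] turns [T_m] into
    [D_m = \sum_k (-1)^k 'C(p-1, k) u_k^m], and binomial duality gives
    [D_m - p D_(m+1) = - h_m] with [h_m] the complete homogeneous symmetric
    function of the reciprocals, whence exact formulas such as [p D_2 = H_1].
    The corrections [T_m - D_m] involve double sums of weight 5, which
    Faulhaber's formula and Fermat's little theorem evaluate modulo [p] as multiples of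
    [B_(p-5)]. Finally [H_2] and [H_4] are reduced to [H_1] and [B_(p-5)] by
    combining the reflection [k -> p - k] with the relations between the [D_m]. *)

(** * Localization of the rationals at p *)

Definition Zloc (p : nat) : {pred rat} := [pred x | p_integral p x].

(** Allowing any denominator prime to p, not only the reduced one, makes closure under subtraction
    and product immediate. *)
Lemma ZlocP (p : nat) (x : rat) :
  reflect (exists2 d : nat, coprime p d & x * d%:R \is a Num.int) (x \in Zloc p).
Proof.
apply: (iffP idP) => [xZ|[d pd /intrP[n xd]]].
  exists `|denq x|%N => //.
  by rewrite pmulrn absz_denq -numqE rpred_int.
have E : (numq x * d%:Z = n * denq x)%R.
  apply: (@intr_inj rat); rewrite !rmorphM /= -xd numqE -pmulrn; ring.
have : (denq x %| numq x * d%:Z)%Z by rewrite E dvdz_mull.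
rewrite Gauss_dvdzr; last by rewrite coprimezE coprime_sym coprime_num_den.
by rewrite dvdzE => /coprime_dvdr; apply.
Qed.

Lemma Zloc_subring p : subring_closed (Zloc p).
Proof.
split.
- by apply/ZlocP; exists 1%N; rewrite ?coprimen1 ?mulr1 ?rpred1.
- move=> x y /ZlocP[d pd dx] /ZlocP[e pe ey]; apply/ZlocP.
  exists (d * e)%N; first by rewrite coprimeMr pd pe.
  rewrite natrM (_ : (x - y) * _ = x * d%:R * e%:R - y * e%:R * d%:R); last ring.
  by apply: rpredB; apply: rpredM => //; apply: rpred_nat.
- move=> x y /ZlocP[d pd dx] /ZlocP[e pe ey]; apply/ZlocP.
  exists (d * e)%N; first by rewrite coprimeMr pd pe.
  rewrite natrM (_ : x * y * _ = (x * d%:R) * (y * e%:R)); last ring.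
  by rewrite rpredM.
Qed.
HB.instance Definition _ p :=
  GRing.isSubringClosed.Build rat (Zloc p) (Zloc_subring p).

Definition pideal (p m : nat) : {pred rat} :=
  [pred x | x / p%:R ^+ m \in Zloc p].

Lemma pideal_zmod p m : zmod_closed (pideal p m).
Proof.
split=> [|x y xI yI]; first by rewrite /pideal unfold_in /= mul0r (rpred0 (Zloc p)).
by rewrite unfold_in /= mulrBl (rpredB xI yI).
Qed.
HB.instance Definition _ p m :=
  GRing.isZmodClosed.Build rat (pideal p m) (pideal_zmod p m).

Section Padic.
Variable p : nat.
Hypothesis p_pr : prime p.
Implicit Types (x y z : rat) (m n k : nat).

Local Notation pr := (p%:R : rat).
Local Notation "x == y 'mod' m" := (x - y \in pideal p m)
  (at level 70, y at next level, m at level 0).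

Lemma pr_neq0 : pr != 0.
Proof. by rewrite pnatr_eq0 -lt0n prime_gt0. Qed.

Lemma pidealP m x :
  reflect (exists2 z, z \in Zloc p & x = pr ^+ m * z) (x \in pideal p m).
Proof.
apply: (iffP idP) => [xI|[z zZ ->]].
  by exists (x / pr ^+ m) => //; rewrite mulrC divfK // expf_neq0 ?pr_neq0.
by rewrite inE mulrC mulKf // expf_neq0 ?pr_neq0.
Qed.

Lemma pideal0 x : (x \in pideal p 0) = (x \in Zloc p).
Proof. by rewrite inE expr0 divr1. Qed.

Lemma pidealM {m n x y} :
  x \in pideal p m -> y \in pideal p n -> x * y \in pideal p (m + n).
Proof.
move=> /pidealP[a aZ ->] /pidealP[b bZ ->]; apply/pidealP; exists (a * b).
  by rewrite rpredM.
by rewrite exprD; ring.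
Qed.

Lemma pideal_mull m x y :
  x \in Zloc p -> y \in pideal p m -> x * y \in pideal p m.
Proof. by rewrite -pideal0; apply: (@pidealM 0). Qed.

Lemma pideal_mulr m x y :
  x \in pideal p m -> y \in Zloc p -> x * y \in pideal p m.
Proof. by move=> xI yZ; rewrite mulrC pideal_mull. Qed.

Lemma pideal_exp m : pr ^+ m \in pideal p m.
Proof. by apply/pidealP; exists 1; rewrite ?rpred1 ?mulr1. Qed.

Lemma pideal_p : pr \in pideal p 1.
Proof. exact: (pideal_exp 1). Qed.

Lemma pideal_pXM m n x : x \in pideal p n -> pr ^+ m * x \in pideal p (m + n).
Proof. exact/pidealM/pideal_exp. Qed.

Lemma pideal_pXMK m n x : (pr ^+ m * x \in pideal p (m + n)) = (x \in pideal p n).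
Proof.
apply/idP/idP; last exact: pideal_pXM.
move=> /pidealP[z zZ]; rewrite exprD -mulrA => /mulfI E.
by apply/pidealP; exists z => //; apply: E; rewrite expf_neq0 ?pr_neq0.
Qed.

Lemma pideal_le {m n x} : (m <= n)%N -> x \in pideal p n -> x \in pideal p m.
Proof.
move=> le_mn /pidealP[z zZ ->]; apply/pidealP; exists (pr ^+ (n - m) * z).
  by rewrite rpredM ?rpredX ?rpred_nat.
by rewrite mulrA -exprD subnKC.
Qed.

Lemma pideal_Zloc {m x} : x \in pideal p m -> x \in Zloc p.
Proof. by move/(pideal_le (leq0n m)); rewrite pideal0. Qed.

Lemma Zloc_invn n : (0 < n < p)%N -> n%:R^-1 \in Zloc p.
Proof.
case/andP=> n_gt0 lt_np; apply/ZlocP; exists n.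
  by rewrite prime_coprime // gtnNdvd.
by rewrite mulVf ?rpred1 // pnatr_eq0 -lt0n.
Qed.

Lemma pideal_trans {m x y z} : x == y mod m -> y == z mod m -> x == z mod m.
Proof.
move=> xy yz; have -> : x - z = (x - y) + (y - z) by ring.
exact: rpredD.
Qed.

Lemma eqmodqP m x y : y \in Zloc p -> x == y mod m -> eqmodq p m x y.
Proof.
move=> yZ xy; split => //; last by case/pidealP: xy => z; exists z.
by rewrite -[x](subrK y); apply: (rpredD (pideal_Zloc xy) yZ).
Qed.

End Padic.

(** * Faulhaber's formula *)

Lemma exprD1_sub (R : comNzRingType) (x : R) (s : nat) :
  (x + 1) ^+ s - x ^+ s = \sum_(l < s) 'C(s, l)%:R * x ^+ l.
Proof.
rewrite addrC (addrC x) exprDn big_ord_recr /= binn mulr1n subnn mul1r.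
rewrite addrC addrK; apply: eq_bigr => l _.
by rewrite expr1n mul1r mulr_natl.
Qed.

(** Both sides are the multinomial coefficient n! / (i! l! (n-i-l)!). *)
Lemma bin_bin_swap (n i l : nat) : (i + l <= n)%N ->
  ('C(n, i) * 'C(n - i, l) = 'C(n, l) * 'C(n - l, i))%N.
Proof.
move=> le_n; have il : (i <= n)%N by lia. have ll : (l <= n)%N by lia.
have li : (l <= n - i)%N by lia. have ii : (i <= n - l)%N by lia.
apply/eqP; rewrite -(eqn_pmul2r (fact_gt0 i)) -(eqn_pmul2r (fact_gt0 l)).
rewrite -(eqn_pmul2r (fact_gt0 (n - i - l))); apply/eqP.
have E1 := bin_fact il. have E2 := bin_fact li.
have E3 := bin_fact ll. have E4 := bin_fact ii.
have E : (n - l - i = n - i - l)%N by lia.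
rewrite -E2 in E1; rewrite -E4 E in E3.
rewrite -{1}E1 in E3; move: E3; lia.
Qed.

(** Induction on n: up to the factor 1/(m+1), the coefficient of n^l in the increment of the right
    side is 'C(m+1, l) times the sum in the Bernoulli recurrence. That sum vanishes unless l = m,
    when it is B_0 = 1. *)
Lemma faulhaber (m n : nat) :
  \sum_(j < n) j%:R ^+ m =
    m.+1%:R^-1 * \sum_(i < m.+1) 'C(m.+1, i)%:R * bernoulli i
                                  * n%:R ^+ (m.+1 - i) :> rat.
Proof.
have m0 : m.+1%:R != 0 :> rat by rewrite pnatr_eq0.
elim: n => [|n IHn].
  rewrite big_ord0 big1 ?mulr0 // => i _.
  by rewrite expr0n subn_eq0 leqNgt ltn_ord mulr0.
rewrite big_ord_recr /= IHn; apply/esym/eqP; rewrite addrC -subr_eq -mulrBr.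
rewrite -sumrB; apply/eqP/(mulfI m0); rewrite mulrA divff // mul1r.
transitivity (\sum_(i < m.+1) \sum_(l < m.+1 | (l < m.+1 - i)%N)
   'C(m.+1, l)%:R * n%:R ^+ l * ('C(m.+1 - l, i)%:R * bernoulli i)).
  apply: eq_bigr => i _; rewrite -mulrBr -natr1 exprD1_sub mulr_sumr.
  rewrite (big_ord_widen m.+1 (fun l => 'C(m.+1, i)%:R * bernoulli i * 
     ('C(m.+1 - i, l)%:R * n%:R ^+ l))) ?leq_subr //.
  apply: eq_bigr => l lt_l.
  have /(congr1 (fun k => k%:R : rat)) : ('C(m.+1, i) * 'C(m.+1 - i, l) =
     'C(m.+1, l) * 'C(m.+1 - l, i))%N by apply: bin_bin_swap; lia.
  rewrite !natrM => E.
  have -> x y z t : x * y * (z * t) = x * z * y * t :> rat by ring.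
  rewrite E; ring.
rewrite (exchange_big_dep predT) //=.
transitivity (\sum_(l < m.+1) 'C(m.+1, l)%:R * n%:R ^+ l * (l == m :> nat)%:R : rat).
  apply: eq_bigr => l _; rewrite -mulr_sumr; congr (_ * _).
  rewrite (eq_bigl (fun i : 'I_m.+1 => (i < m.+1 - l)%N)); last first.
    by move=> i; lia.
  rewrite -(big_ord_widen m.+1 (fun i => 'C(m.+1 - l, i)%:R * bernoulli i)) ?leq_subr //.
  case: eqVneq => [->|ne]; first by rewrite subSnn big_ord1 bin0 mul1r.
  have -> : (m.+1 - l = (m - l).+1)%N by have := ltn_ord l; lia.
  rewrite -(big_mkord xpredT (fun i => 'C((m - l).+1, i)%:R * bernoulli i)).
  by apply: bernoulli_sum; have := ltn_ord l; lia.
rewrite big_ord_recr /= big1 ?add0r => [|l _].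
  by rewrite eqxx mulr1 binSn.
by rewrite (ltn_eqF (ltn_ord l)) mulr0.
Qed.

(** * Power sums modulo p *)

(* The index is shifted: [recip k] is 1/(k+1), so sums over
   [k < n] run over 1, ..., 1/n. *)
Definition recip (k : nat) : rat := k.+1%:R^-1.

Definition hsum (s n : nat) : rat := \sum_(k < n) recip k ^+ s.

Lemma mulr_recip k : k.+1%:R * recip k = 1.
Proof. by rewrite divff // pnatr_eq0. Qed.

Lemma hsum0 s : hsum s 0 = 0.
Proof. by rewrite /hsum big_ord0. Qed.

Lemma hsumS s n : hsum s n.+1 = hsum s n + recip n ^+ s.
Proof. by rewrite /hsum big_ord_recr. Qed.

Section PowerSums.
Variable p : nat.
Hypothesis p_pr : prime p.

Local Notation "x == y 'mod' m" := (x - y \in pideal p m)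
  (at level 70, y at next level, m at level 0).

Lemma recip_Zloc k : (k < p.-1)%N -> recip k \in Zloc p.
Proof. by move=> lt_k; apply: Zloc_invn => //; lia. Qed.

Lemma hsum_Zloc s n : (n <= p.-1)%N -> hsum s n \in Zloc p.
Proof.
move=> le_n; apply: rpred_sum => k _; apply/rpredX/recip_Zloc.
by have := ltn_ord k; lia.
Qed.

Lemma bernoulli_Zloc n : (n.+1 < p)%N -> bernoulli n \in Zloc p.
Proof.
elim/ltn_ind: n => -[_ _|n IHn lt_np]; first exact: rpred1.
have := @bernoulli_sum n.+1 isT; rewrite big_nat_recr //= binSn mulrC => /eqP.
rewrite addr_eq0 -eqr_oppLR => /eqP E.
have n0 : n.+2%:R != 0 :> rat by rewrite pnatr_eq0.
rewrite -[bernoulli _](mulfK n0) -E mulNr rpredN; apply: rpredM.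
  rewrite big_mkord; apply: rpred_sum => i _; apply: rpredM.
    exact: rpred_nat.
  by apply: IHn; have := ltn_ord i; lia.
by apply: Zloc_invn.
Qed.

(** In Faulhaber's formula at n = p each term has a factor p, and e+1 < p keeps 1/(e+1) and the
    Bernoulli numbers p-integral. *)
Lemma sum_pow_pideal e :
  (0 < e)%N -> (e < p.-1)%N -> \sum_(k < p.-1) k.+1%:R ^+ e \in pideal p 1.
Proof.
move=> e_gt0 lt_e.
have -> : \sum_(k < p.-1) k.+1%:R ^+ e = \sum_(j < p) j%:R ^+ e :> rat.
  rewrite -[in RHS](prednK (prime_gt0 p_pr)) big_ord_recl /= expr0n.
  by rewrite eqn0Ngt e_gt0 add0r.
rewrite faulhaber; apply: pideal_mull => //; first by apply: Zloc_invn => //; lia.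
apply: rpred_sum => i _; have lt_i := ltn_ord i; apply: pideal_mull => //.
  by apply: rpredM; [apply: rpred_nat | apply: bernoulli_Zloc; lia].
by apply: (@pideal_le _ p_pr _ (e.+1 - i)); [lia | apply: pideal_exp].
Qed.

Lemma fermat_pideal k : (k < p.-1)%N -> k.+1%:R ^+ p.-1 == 1 mod 1.
Proof.
move=> lt_k; have k_p : ~~ (p %| k.+1)%N by rewrite gtnNdvd //; lia.
have: (p %| k.+1 ^ p.-1 - 1)%N.
  rewrite -(@Gauss_dvdr p k.+1) ?prime_coprime // mulnBr -expnS muln1.
  rewrite prednK ?prime_gt0 // -eqn_mod_dvd ?(fermat_little _ p_pr) //.
  by rewrite -[leqLHS]expn1 leq_pexp2l // prime_gt0.
case/dvdnP=> q E; apply/pidealP => //; exists q%:R; first exact: rpred_nat.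
rewrite expr1 -natrM mulnC -E natrB ?natrX //.
by rewrite expn_gt0.
Qed.

Lemma fermat_recip a k : (k < p.-1)%N -> (a <= p.-1)%N ->
  recip k ^+ a == k.+1%:R ^+ (p.-1 - a) mod 1.
Proof.
move=> lt_k le_a.
have -> : recip k ^+ a - k.+1%:R ^+ (p.-1 - a) =
    - (recip k ^+ a * (k.+1%:R ^+ p.-1 - 1)).
  rewrite -{2}(subnK le_a) exprD mulrBr mulr1 mulrCA -exprMn.
  by rewrite [recip k * _]mulrC mulr_recip expr1n mulr1 opprB.
by rewrite rpredN pideal_mull // ?fermat_pideal // rpredX ?recip_Zloc.
Qed.

Lemma hsum_pideal s : (0 < s)%N -> (s < p.-1)%N -> hsum s p.-1 \in pideal p 1.
Proof.
move=> s_gt0 lt_s.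
rewrite -[hsum _ _](subrK (\sum_(k < p.-1) k.+1%:R ^+ (p.-1 - s))).
apply: rpredD; last by apply: sum_pow_pideal; lia.
rewrite -sumrB; apply: rpred_sum => -[k lt_k] _ /=.
by apply: fermat_recip => //; lia.
Qed.

(** Orthogonality of powers over the nonzero residues: the bounds say |e - b| < p - 1, so the sum is
    nonzero modulo p only for e = b, where it is p - 1. *)
Lemma sum_pow_recip e b : (e < b + p.-1)%N -> (b < e + p.-1)%N ->
  \sum_(k < p.-1) k.+1%:R ^+ e * recip k ^+ b == - (e == b)%:R mod 1.
Proof.
move=> lt_e lt_b.
have E k : k.+1%:R ^+ e * recip k ^+ b =
    k.+1%:R ^+ (e - b) * recip k ^+ (b - e).
  case: (leqP e b) => [le_eb | /ltnW le_be].
    rewrite -{1}(subnKC le_eb) exprD mulrA -exprMn mulr_recip expr1n.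
    by rewrite (eqP le_eb) expr0.
  rewrite -{1}(subnK le_be) exprD -mulrA -exprMn mulr_recip expr1n.
  by rewrite (eqP le_be) expr0.
under eq_bigr do rewrite E.
case: (ltngtP e b) => [lt_eb | lt_be | ->].
- rewrite (eqP (ltnW lt_eb)) oppr0 subr0.
  under eq_bigr do rewrite expr0 mul1r.
  by apply: (hsum_pideal (b - e)); lia.
- rewrite (eqP (ltnW lt_be)) oppr0 subr0.
  under eq_bigr do rewrite expr0 mulr1.
  by apply: sum_pow_pideal; lia.
rewrite subnn opprK.
under eq_bigr do rewrite !expr0 mulr1.
rewrite big_const_ord iter_addr_0 natr1 prednK ?prime_gt0 //.
exact: pideal_p.
Qed.

(** By Fermat H_a(k) becomes a sum of M-th powers with M = p-1-a, and by Faulhaber a polynomial in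
    k+1; orthogonality against (k+1)^(-b) keeps only the term i = p-(a+b). *)
Lemma hsum_recip_pideal a b : (0 < a)%N -> (0 < b)%N -> (a + b < p)%N ->
  \sum_(k < p.-1) hsum a k * recip k ^+ b
    == - ((p - a)%:R^-1 * 'C(p - a, b)%:R * bernoulli (p - (a + b))) mod 1.
Proof.
move=> a_gt0 b_gt0 lt_ab.
pose M := (p.-1 - a)%N.
have EM : (p - a = M.+1)%N by rewrite /M; lia.
have step1 : \sum_(k < p.-1) hsum a k * recip k ^+ b ==
    \sum_(k < p.-1) (\sum_(j < k.+1) j%:R ^+ M) * recip k ^+ b mod 1.
  rewrite -sumrB; apply: rpred_sum => -[k lt_k] _ /=.
  rewrite -mulrBl pideal_mulr ?rpredX ?recip_Zloc // big_ord_recl /= expr0n.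
  (* The power sum starts at j = 0; this term is 0 because b > 0 forces M > 0. *)
  rewrite (_ : (M == 0)%N = false) ?add0r; last by apply/eqP; rewrite /M; lia.
  rewrite -sumrB; apply: rpred_sum => -[j lt_j] _ /=.
  by apply: fermat_recip => //; lia.
apply: (pideal_trans _ step1); rewrite EM.
under eq_bigr do rewrite faulhaber -mulrA mulr_suml.
rewrite -mulr_sumr exchange_big /= -mulrA -mulrN -mulrBr.
apply: pideal_mull => //; first by apply: Zloc_invn => //; lia.
under eq_bigr do under eq_bigr do rewrite -mulrA.
under eq_bigr do rewrite -mulr_sumr.
have -> : - ('C(M.+1, b)%:R * bernoulli (p - (a + b))) =
   \sum_(i < M.+1) 'C(M.+1, i)%:R * bernoulli i * - (M.+1 - i == b)%N%:R.
  have lt_i : (p - (a + b) < M.+1)%N by lia.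
  rewrite (bigD1 (Ordinal lt_i)) //= big1 ?addr0 => [|i ne_i].
    rewrite (_ : (_ == b)%N); last by lia.
    rewrite mulrN1 -bin_sub; last lia.
    by have -> : (M.+1 - b = p - (a + b))%N by lia.
  rewrite (_ : (M.+1 - i == b)%N = false) ?oppr0 ?mulr0 //.
  by apply/negbTE; move: ne_i; rewrite -val_eqE /=; have := ltn_ord i; lia.
rewrite -sumrB; apply: rpred_sum => i _; have lt_i := ltn_ord i.
rewrite -mulrBr; apply: pideal_mull => //.
  by apply: rpredM; [apply: rpred_nat | apply: bernoulli_Zloc; lia].
by apply: sum_pow_recip; lia.
Qed.

End PowerSums.

(** * Binomial duality *)

(* The complete homogeneous symmetric polynomial of degree m in 1, 1/2, ..., 1/n. *)
Fixpoint hcomp (m n : nat) : rat :=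
  if m is l.+1 then \sum_(j < n) recip j * hcomp l j.+1 else 1.

Lemma hcompS m n : hcomp m.+1 n.+1 = hcomp m.+1 n + recip n * hcomp m n.+1.
Proof. by rewrite /= big_ord_recr. Qed.

Lemma sum_bin_alt n : (0 < n)%N ->
  \sum_(k < n) (-1) ^+ k * 'C(n, k.+1)%:R = 1 :> rat.
Proof.
move=> n_gt0; have := exprBn (1 : rat) 1 n.
rewrite subrr expr0n eqn0Ngt n_gt0 big_ord_recl /= bin0 expr0 !expr1n !mulr1.
rewrite mulr1n => /eqP; rewrite eq_sym addr_eq0 => /eqP/esym.
rewrite -sumrN => E; rewrite -[RHS]E.
apply: eq_bigr => k _; rewrite !expr1n !mulr1 exprS mulN1r mulNrn opprK.
by rewrite mulr_natr.
Qed.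

(** Pascal's rule together with 'C(n, k) / (k+1) = 'C(n+1, k+1) / (n+1). It matches the recurrence
    [hcompS], whence the duality. *)
Lemma sum_bin_recipS m n :
  \sum_(k < n.+1) (-1) ^+ k * 'C(n.+1, k.+1)%:R * recip k ^+ m.+1 =
  \sum_(k < n) (-1) ^+ k * 'C(n, k.+1)%:R * recip k ^+ m.+1 +
  recip n * \sum_(k < n.+1) (-1) ^+ k * 'C(n.+1, k.+1)%:R * recip k ^+ m.
Proof.
transitivity (\sum_(k < n.+1) (-1) ^+ k * 'C(n, k.+1)%:R * recip k ^+ m.+1 +
   recip n * \sum_(k < n.+1) (-1) ^+ k * 'C(n.+1, k.+1)%:R * recip k ^+ m).
  rewrite mulr_sumr -big_split /=; apply: eq_bigr => k _.
  have /(congr1 (fun k => k%:R : rat)) := mul_bin_diag n.+1 k.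
  rewrite !natrM /= => E.
  have {E} E : recip n * 'C(n.+1, k.+1)%:R = 'C(n, k)%:R * recip k.
    apply: (mulfI (_ : n.+1%:R != 0)); first by rewrite pnatr_eq0.
    by rewrite mulrA mulr_recip mul1r mulrA E mulrAC mulr_recip mul1r.
  rewrite !mulrA (mulrAC (recip n)) E binS natrD exprS; ring.
by rewrite big_ord_recr /= bin_small // mulr0 mul0r addr0.
Qed.

Lemma sum_bin_recip m n :
  \sum_(k < n) (-1) ^+ k * 'C(n, k.+1)%:R * recip k ^+ m.+1 = hcomp m.+1 n.
Proof.
elim: m n => [|m IHm]; elim=> [|n IHn]; rewrite ?[LHS]big_ord0 ?[RHS]big_ord0 //.
  rewrite sum_bin_recipS hcompS IHn; congr (_ + _ * _).
  under eq_bigr do rewrite expr0 mulr1.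
  exact: sum_bin_alt.
by rewrite sum_bin_recipS hcompS IHn IHm.
Qed.

Definition mprod (x : rat) n := \prod_(j < n) (1 - x * recip j).

Lemma mprodS x n : mprod x n.+1 = mprod x n * (1 - x * recip n).
Proof. by rewrite /mprod big_ord_recr. Qed.

Lemma mprod_bin N k : mprod N.+1%:R k = (-1) ^+ k * 'C(N, k)%:R.
Proof.
elim: k => [|k IHk]; first by rewrite /mprod big_ord0 bin0 mulr1.
have k0 : k.+1%:R != 0 :> rat by rewrite pnatr_eq0.
rewrite mprodS IHk; apply: (mulfI k0).
have /(congr1 (fun k => k%:R : rat)) := mul_bin_left N k.
rewrite !natrM => E; rewrite [RHS]mulrCA {}E exprS.
have -> : k.+1%:R * ((-1) ^+ k * 'C(N, k)%:R * (1 - N.+1%:R * recip k)) =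
  (-1) ^+ k * ('C(N, k)%:R * (k.+1%:R - N.+1%:R)) :> rat.
  by rewrite /recip; field; rewrite nat1r.
rewrite mulN1r mulNr -mulrN; congr (_ * _).
(* The truncated N - k is the true difference only for k <= N; beyond that 'C(N, k) is 0. *)
case: (leqP k N) => [le_kN|/bin_small->]; last by rewrite mulr0 mul0r oppr0.

by rewrite (natrB _ le_kN) -!natr1; ring.
Qed.

Lemma mprod_binN n k : mprod (- n%:R) k = 'C(n + k, k)%:R.
Proof.
elim: k => [|k IHk]; first by rewrite /mprod big_ord0 bin0.
have k0 : k.+1%:R != 0 :> rat by rewrite pnatr_eq0.
rewrite mprodS IHk; apply: (mulfI k0); rewrite -natrM addnS -mul_bin_diag natrM /=.
by rewrite /recip -addnS natrD; field; rewrite nat1r.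
Qed.

Section Duality.
Variables (N : nat).
Local Notation P := (N.+1%:R : rat).

Definition dsum (m : nat) : rat := \sum_(k < N) mprod P k * recip k ^+ m.

(** The factor 1 - p u_k turns [mprod P k] into [mprod P k.+1], that is, into (-1)^(k+1) 'C(N, k+1),
    and [sum_bin_recip] applies. *)
Lemma dsumS m : dsum m.+1 - P * dsum m.+2 = - hcomp m.+1 N.
Proof.
rewrite -sum_bin_recip /dsum mulr_sumr -sumrB -sumrN; apply: eq_bigr => k _.
have := mprod_bin N k.+1; rewrite mprodS exprS mulN1r mulNr => /eqP.
rewrite -eqr_oppLR => /eqP <-; rewrite [recip k ^+ m.+2]exprS; ring.
Qed.

(** Multiplied by p, the sum becomes the alternating sum of the 'C(p, k+1) without its last term;
    both the full sum and that term are 1. *)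
Lemma dsum1 : ~~ odd N -> dsum 1 = 0.
Proof.
move=> evenN; apply: (mulfI (_ : P != 0)); first by rewrite pnatr_eq0.
have := @sum_bin_alt N.+1 isT; rewrite big_ord_recr /= binn.
rewrite -signr_odd (negbTE evenN) mulr1 => /(canRL (addrK _)).
rewrite subrr mulr0 => <-.
rewrite /dsum mulr_sumr; apply: eq_bigr => k _.
have /(congr1 (fun k => k%:R : rat)) := mul_bin_diag N.+1 k.
rewrite !natrM /= mprod_bin expr1 => E.
have -> : P * ((-1) ^+ k * 'C(N, k)%:R * recip k) =
  (-1) ^+ k * (P * 'C(N, k)%:R) * recip k by ring.
by rewrite E -!mulrA ['C(_, _)%:R * _]mulrC (mulrA k.+1%:R) mulr_recip mul1r.
Qed.

End Duality.

Lemma hcomp1E n : hcomp 1 n = hsum 1 n.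
Proof. by rewrite /= /hsum; apply: eq_bigr => k _; rewrite expr1 mulr1. Qed.

(** This and the next two lemmas write m! h_m in power sums; the coefficients count the permutations
    of m letters by cycle type. *)
Lemma hcomp2E n : 2 * hcomp 2 n = hsum 1 n ^+ 2 + hsum 2 n.
Proof.
elim: n => [|n IHn]; first by rewrite !hsum0 /= big_ord0; ring.
by rewrite hcompS mulrDr IHn hcomp1E !hsumS; ring.
Qed.

Lemma hcomp3E n :
  6 * hcomp 3 n = hsum 1 n ^+ 3 + 3 * hsum 1 n * hsum 2 n + 2 * hsum 3 n.
Proof.
elim: n => [|n IHn]; first by rewrite !hsum0 /= big_ord0; ring.
rewrite hcompS mulrDr IHn.
have -> : 6 * (recip n * hcomp 2 n.+1) = 3 * recip n * (2 * hcomp 2 n.+1) by ring.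
by rewrite hcomp2E !hsumS; ring.
Qed.

Lemma hcomp4E n :
  24 * hcomp 4 n = hsum 1 n ^+ 4 + 6 * hsum 1 n ^+ 2 * hsum 2 n
    + 3 * hsum 2 n ^+ 2 + 8 * hsum 1 n * hsum 3 n + 6 * hsum 4 n.
Proof.
elim: n => [|n IHn]; first by rewrite !hsum0 /= big_ord0; ring.
rewrite hcompS mulrDr IHn.
have -> : 24 * (recip n * hcomp 3 n.+1) = 4 * recip n * (6 * hcomp 3 n.+1) by ring.
by rewrite hcomp3E !hsumS; ring.
Qed.

(** * The congruences *)

Section Congruences.
Variable N : nat.
Hypothesis p_pr : prime N.+1.
Hypothesis p_gt5 : (5 < N.+1)%N.

Local Notation P := (N.+1%:R : rat).
Local Notation "x == y 'mod' m" := (x - y \in pideal N.+1 m)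
  (at level 70, y at next level, m at level 0).
Local Notation H1 := (hsum 1 N).
Local Notation H2 := (hsum 2 N).
Local Notation H3 := (hsum 3 N).
Local Notation H4 := (hsum 4 N).
Local Notation H5 := (hsum 5 N).
Local Notation B := (bernoulli (N.+1 - 5)).

Let uZ k : (k < N)%N -> recip k \in Zloc N.+1.
Proof. exact: (@recip_Zloc _ p_pr). Qed.

Let HZ s k : (k <= N)%N -> hsum s k \in Zloc N.+1.
Proof. exact: (@hsum_Zloc _ p_pr). Qed.

(** Excludes 6, so that 5 < p - 1 and H_5 is still in the range where power sums vanish modulo p. *)
Lemma prime_gt6 : (6 < N.+1)%N.
Proof. by rewrite ltn_neqAle p_gt5 andbT; apply: contraTneq p_pr => <-. Qed.

(** * The reflection of the residues and Wolstenholme's theorem *)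

Lemma sum_rev (f : nat -> rat) : \sum_(k < N) f k = \sum_(k < N) f (N - k.+1)%N.
Proof. by rewrite (reindex_inj rev_ord_inj). Qed.

(** The left side recurs in the last term, so repeated substitution expands 1/(p-j), with j = k+1,
    in powers of p. *)
Lemma recip_rev k : (k < N)%N ->
  recip (N - k.+1) = - recip k + P * (recip k * recip (N - k.+1)).
Proof.
move=> lt_k; have E : P = k.+1%:R + (N - k.+1).+1%:R :> rat.
  by rewrite -natrD; congr _%:R; lia.
rewrite E /recip; field.
by rewrite !nat1r !pnatr_eq0.
Qed.

Lemma recip_revD k : (k < N)%N -> recip (N - k.+1) + recip k \in pideal N.+1 1.
Proof.
move=> lt_k; rewrite {1}recip_rev // addrC addNKr.
apply: pideal_mulr => //; first exact: pideal_p.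
by apply: rpredM; apply: uZ; lia.
Qed.

Lemma hsum_small s : (0 < s)%N -> (s <= 5)%N -> hsum s N \in pideal N.+1 1.
Proof. by move=> s0 s5; apply: hsum_pideal => //=; have := prime_gt6; lia. Qed.

(* Sums over k the expansion of 1/(p - k) in powers of p. *)
Lemma wolstenholme_rev :
  2 * H1 + P * H2 + P ^+ 2 * H3 + P ^+ 3 * H4 \in pideal N.+1 5.
Proof.
have E : \sum_(k < N) recip (N - k.+1) = - H1 - P * H2 - P ^+ 2 * H3 - P ^+ 3 * H4
   - P ^+ 4 * H5 + P ^+ 5 * \sum_(k < N) recip k ^+ 5 * recip (N - k.+1).
  rewrite /hsum !mulr_sumr -!sumrN -!big_split /=; apply: eq_bigr => k _.
  have R := recip_rev k (ltn_ord k).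
  by do 5 rewrite {1}R; ring.
have {E} -> : 2 * H1 + P * H2 + P ^+ 2 * H3 + P ^+ 3 * H4 =
   P ^+ 5 * \sum_(k < N) recip k ^+ 5 * recip (N - k.+1) - P ^+ 4 * H5.
  have : H1 = \sum_(k < N) recip (N - k.+1) by rewrite -(sum_rev recip).
  by rewrite {}E => E; rewrite mulr2n mulrDl mul1r {1}E; ring.
apply: rpredB.
  apply: pideal_mulr => //; first exact: pideal_exp.
  apply: rpred_sum => k _; have := ltn_ord k => lt_k.
  by apply: rpredM; first apply: rpredX; apply: uZ; lia.
by apply: (pideal_pXM _ p_pr 4 1); apply: hsum_small.
Qed.

Lemma Zloc_inv k : (0 < k <= 5)%N -> k%:R^-1 \in Zloc N.+1.
Proof. by move=> k5; apply: Zloc_invn => //; lia. Qed.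

Lemma pideal_natMK k m x : (0 < k <= 5)%N ->
  (k%:R * x \in pideal N.+1 m) = (x \in pideal N.+1 m).
Proof.
move=> k5; have k0 : k%:R != 0 :> rat by rewrite pnatr_eq0; lia.
apply/idP/idP => [I|]; last by apply: pideal_mull; rewrite ?rpred_nat.
by rewrite -(mulKf k0 x) pideal_mull // Zloc_inv.
Qed.

Lemma wolstenholme : H1 \in pideal N.+1 2.
Proof.
rewrite -(pideal_natMK 2) //.
have -> : 2 * H1 = (2 * H1 + P * H2 + P ^+ 2 * H3 + P ^+ 3 * H4)
   - P * H2 - P ^+ 2 * (H3 + P * H4) by ring.
apply: rpredB; first apply: rpredB.
- by apply: pideal_le wolstenholme_rev.
- by apply: (pideal_pXM _ p_pr 1 1); apply: hsum_small.
apply: pideal_mulr => //; first exact: pideal_exp.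
by apply: rpredD; [apply: HZ | apply: rpredM; [apply: rpred_nat | apply: HZ]].
Qed.

(** * Expansions of the products in powers of p *)

Lemma mprod_mod k : (k <= N)%N -> mprod P k == 1 - P * hsum 1 k mod 2.
Proof.
elim: k => [_|k IHk lt_k].
  by rewrite hsum0 /mprod big_ord0 mulr0 subr0 subrr rpred0.
rewrite mprodS hsumS.
have -> : mprod P k * (1 - P * recip k) - (1 - P * (hsum 1 k + recip k ^+ 1)) =
  (mprod P k - (1 - P * hsum 1 k)) * (1 - P * recip k)
    + P ^+ 2 * (hsum 1 k * recip k) by ring.
apply: rpredD; apply: pideal_mulr => //.
- by apply: IHk; lia.
- apply: rpredB; first exact: rpred1.
  by apply: rpredM; [apply: rpred_nat | apply: uZ].
- exact: pideal_exp.
by apply: rpredM; [apply: HZ; lia | apply: uZ].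
Qed.

(** The product of the factors 1 - p^2 u_j^2, kept as two products since each is a binomial
    coefficient up to sign. *)
Definition cprod k := mprod P k * mprod (- P) k.

Lemma cprodS k : cprod k.+1 = cprod k * (1 - P ^+ 2 * recip k ^+ 2).
Proof. by rewrite /cprod !mprodS; ring. Qed.

(** The coefficients come from the elementary symmetric functions e_1 and e_2 of the u_j^2, written
    in power sums; the next one comes with p^6. *)
Lemma cprod_mod6 k : (k <= N)%N ->
  cprod k == 1 - P ^+ 2 * hsum 2 k + P ^+ 4 * (2^-1 * (hsum 2 k ^+ 2 - hsum 4 k)) mod 6.
Proof.
elim: k => [_|k IHk lt_k].
  rewrite !hsum0 /cprod /mprod !big_ord0.
  have -> : 1 * 1 - (1 - P ^+ 2 * 0 + P ^+ 4 * (2^-1 * (0 ^+ 2 - 0))) = 0 :> rat by ring.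
  exact: rpred0.
rewrite cprodS !hsumS; move: IHk => /(_ (ltnW lt_k)).
set e := 2^-1 * (hsum 2 k ^+ 2 - hsum 4 k) => IHk.
have -> : 2^-1 * ((hsum 2 k + recip k ^+ 2) ^+ 2 - (hsum 4 k + recip k ^+ 4)) =
    e + hsum 2 k * recip k ^+ 2 by rewrite /e; field.
have -> : cprod k * (1 - P ^+ 2 * recip k ^+ 2)
    - (1 - P ^+ 2 * (hsum 2 k + recip k ^+ 2)
         + P ^+ 4 * (e + hsum 2 k * recip k ^+ 2)) =
  (cprod k - (1 - P ^+ 2 * hsum 2 k + P ^+ 4 * e)) * (1 - P ^+ 2 * recip k ^+ 2)
  - P ^+ 6 * (e * recip k ^+ 2) by ring.
have k2Z : recip k ^+ 2 \in Zloc N.+1 by apply/rpredX/uZ.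
apply: rpredB; apply: pideal_mulr => //.
- apply: rpredB; first exact: rpred1.
  by apply: rpredM => //; apply/rpredX/rpred_nat.
- exact: pideal_exp.
apply: rpredM => //; apply: rpredM; first exact: Zloc_inv.
by apply: rpredB; [apply: rpredX|]; apply: HZ; lia.
Qed.

Lemma cprod_mod4 k : (k <= N)%N -> cprod k == 1 - P ^+ 2 * hsum 2 k mod 4.
Proof.
move=> le_k; set e := 2^-1 * (hsum 2 k ^+ 2 - hsum 4 k).
have -> : cprod k - (1 - P ^+ 2 * hsum 2 k) =
  cprod k - (1 - P ^+ 2 * hsum 2 k + P ^+ 4 * e) + P ^+ 4 * e by ring.
apply: rpredD; first by apply: (@pideal_le _ p_pr _ 6) => //; apply: cprod_mod6.
apply: pideal_mulr => //; first exact: pideal_exp.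
apply: rpredM; first exact: Zloc_inv.
by apply: rpredB; [apply: rpredX|]; apply: HZ.
Qed.

(** * Multiple harmonic sums of weight 5 modulo p *)

Definition msum a b := \sum_(k < N) hsum a k * recip k ^+ b.

Lemma msum_Zloc a b : msum a b \in Zloc N.+1.
Proof.
apply: rpred_sum => k _; have lt_k := ltn_ord k.
by apply: rpredM; [apply/HZ/ltnW | apply/rpredX/uZ].
Qed.

Lemma B_Zloc : B \in Zloc N.+1.
Proof. by apply: bernoulli_Zloc => //; lia. Qed.

Lemma bin_N4 : 'C(N, 4)%:R == 1 mod 1.
Proof.
have := mprod_bin N 4; rewrite (_ : (-1) ^+ 4 = 1 :> rat) // mul1r => <-.
have -> : mprod P 4 - 1 = (mprod P 4 - (1 - P * hsum 1 4)) - P * hsum 1 4 by ring.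
apply: rpredB.
  by apply: (@pideal_le _ p_pr _ 2) => //; apply: mprod_mod; lia.
apply: pideal_mulr => //; first exact: pideal_p.
by apply: HZ; lia.
Qed.

(** The general evaluation has coefficient -'C(p-1, 4) / (p-1), which is 1 modulo p. *)
Lemma msum14 : msum 1 4 == B mod 1.
Proof.
have N0 : N%:R != 0 :> rat by rewrite pnatr_eq0; lia.
have := @hsum_recip_pideal _ p_pr 1 4 isT isT p_gt5; rewrite subn1 /=.
move/pideal_trans; apply.
have -> : - (N%:R^-1 * 'C(N, 4)%:R * B) - B =
  - (N%:R^-1 * (('C(N, 4)%:R - 1) + P) * B).
  by rewrite -natr1; field.
rewrite rpredN; apply: pideal_mulr B_Zloc => //; apply: pideal_mull => //.
  by apply: Zloc_invn => //; lia.
by apply: rpredD; [apply: bin_N4 | apply: pideal_p].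
Qed.

(** Here the coefficient is -'C(p-2, 3) / (p-2) = -4 'C(p-1, 4) / ((p-1)(p-2)), which is -4/2 modulo
    p. *)
Lemma msum23 : msum 2 3 == - 2 * B mod 1.
Proof.
have N0 : N%:R != 0 :> rat by rewrite pnatr_eq0; lia.
have N1 : N.-1%:R != 0 :> rat by rewrite pnatr_eq0; lia.
have := @hsum_recip_pideal _ p_pr 2 3 isT isT p_gt5.
move/pideal_trans; apply.
have -> : (N.+1 - 2 = N.-1)%N by lia.
have /(congr1 (fun k => k%:R : rat)) := mul_bin_diag N 3.
rewrite !natrM => E.
have {E} -> : 'C(N.-1, 3)%:R = N%:R^-1 * 4 * 'C(N, 4)%:R :> rat.
  by rewrite -mulrA -E mulKf.
have EN : N%:R = N.-1%:R + 1 :> rat by rewrite natr1; congr _%:R; lia.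
(* The term P (2 P - 6) is 2 (p-1) (p-2) - 4. *)
have -> : - (N.-1%:R^-1 * (N%:R^-1 * 4 * 'C(N, 4)%:R) * B) - - 2 * B =
  - (N.-1%:R^-1 * (N%:R^-1 * (4 * ('C(N, 4)%:R - 1) - P * (2 * P - 6))) * B).
  by rewrite -[P]natr1 EN; field; rewrite -EN N0 N1.
rewrite rpredN; apply: pideal_mulr B_Zloc => //.
do 2 (apply: pideal_mull => //; first by apply: Zloc_invn => //; lia).
apply: rpredB; first by rewrite pideal_natMK // bin_N4.
apply: pideal_mulr => //; first exact: pideal_p.
by rewrite rpredB ?rpredM ?rpred_nat.
Qed.

Lemma hsum2_rev m : (m <= N)%N -> hsum 2 (N - m) + hsum 2 m \in pideal N.+1 1.
Proof.
elim: m => [_|m IHm lt_m].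
  by rewrite subn0 hsum0 addr0 hsum_small.
have E : hsum 2 (N - m) = hsum 2 (N - m.+1) + recip (N - m.+1) ^+ 2.
  by rewrite -hsumS; congr (hsum 2 _); lia.
have -> : hsum 2 (N - m.+1) + hsum 2 m.+1 = (hsum 2 (N - m) + hsum 2 m)
    + (recip (N - m.+1) + recip m) * (recip m - recip (N - m.+1)).
  by rewrite E hsumS; ring.
apply: rpredD; first by apply: IHm; lia.
apply: pideal_mulr => //; first exact: recip_revD.
by apply: rpredB; apply: uZ; lia.
Qed.

(** The p^3 correction in T_2: one H_1 comes from [mprod] and one H_2 from [cprod]. *)
Definition wsum := \sum_(k < N) hsum 1 k * hsum 2 k * recip k ^+ 2.

(* Telescope [H_1(k) H_2(k)^2]; the remaining sum V of [H_2(k)^2 / (k+1)] is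
   evaluated modulo p by the reflection, under which [H_2] is antisymmetric. *)
Lemma wsum_mod : 2 * wsum + msum 1 4 + msum 2 3 \in pideal N.+1 1.
Proof.
pose V := \sum_(k < N) hsum 2 k ^+ 2 * recip k.
(* V is added to its reflected copy; the partner of H_2(N-k-1) is H_2(k+1), whose square produces
   the extra terms [msum 2 3] and H_5. *)
have VI : 2 * V + 2 * msum 2 3 + H5 \in pideal N.+1 1.
  have -> : 2 * V + 2 * msum 2 3 + H5 =
      \sum_(k < N) (hsum 2 (N - k.+1) ^+ 2 * recip (N - k.+1)
                    + hsum 2 k.+1 ^+ 2 * recip k).
    rewrite big_split /= -(sum_rev (fun k => hsum 2 k ^+ 2 * recip k)) -/V.
    rewrite mulr2n mulrDl mul1r -!addrA; congr (_ + _).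
    rewrite /V /msum /hsum mulr_sumr -!big_split /=; apply: eq_bigr => k _.
    by rewrite -/(hsum 2 k) -/(hsum 2 k.+1) hsumS; ring.
  apply: rpred_sum => k _; have lt_k := ltn_ord k.
  have -> : hsum 2 (N - k.+1) ^+ 2 * recip (N - k.+1) + hsum 2 k.+1 ^+ 2 * recip k =
     (recip (N - k.+1) + recip k) * hsum 2 (N - k.+1) ^+ 2
     + (hsum 2 (N - k.+1) + hsum 2 k.+1)
        * ((hsum 2 k.+1 - hsum 2 (N - k.+1)) * recip k) by ring.
  apply: rpredD; apply: pideal_mulr => //.
  - exact: recip_revD.
  - by apply/rpredX/HZ/leq_subr.
  - exact: hsum2_rev.
  by apply: rpredM; [apply: rpredB; apply: HZ; lia | apply: uZ].
have E : H1 * H2 ^+ 2 = 2 * wsum + msum 1 4 + V + 2 * msum 2 3 + H5.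
  rewrite {VI}/V /wsum /msum; elim: N => [|n IHn]; first by rewrite !hsum0 !big_ord0; ring.
  rewrite !big_ord_recr /= !hsumS.
  have -> : (hsum 1 n + recip n ^+ 1) * (hsum 2 n + recip n ^+ 2) ^+ 2 =
    hsum 1 n * hsum 2 n ^+ 2 + (2 * hsum 1 n * hsum 2 n * recip n ^+ 2
    + hsum 1 n * recip n ^+ 4 + recip n * hsum 2 n ^+ 2 + 2 * hsum 2 n * recip n ^+ 3
    + recip n ^+ 5) by ring.
  by rewrite IHn; ring.
rewrite -(pideal_natMK 2) //.
have -> : 2 * (2 * wsum + msum 1 4 + msum 2 3) =
  2 * (H1 * H2 ^+ 2) - (2 * V + 2 * msum 2 3 + H5) - H5 by rewrite E; ring.
apply: rpredB; last exact: hsum_small.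
apply: rpredB => //; rewrite pideal_natMK //; apply: pideal_mulr => //.
  exact: hsum_small.
by apply/rpredX/HZ.
Qed.

Lemma wsum_B : 2 * wsum == B mod 1.
Proof.
have -> : 2 * wsum - B = (2 * wsum + msum 1 4 + msum 2 3)
  - (msum 1 4 - B) - (msum 2 3 - - 2 * B) by ring.
by apply: rpredB; [apply: rpredB|]; [apply: wsum_mod | apply: msum14 | apply: msum23].
Qed.

(** * Relations between the D_m, and the reduction of H_4 and H_2 *)

Let oddN : ~~ odd N.
Proof. by case: (even_prime p_pr) => [E|/=]; first by move: p_gt5; rewrite E. Qed.

Let d2E : P * dsum N 2 = H1.
Proof.
have := dsumS N 0; rewrite dsum1 // hcomp1E sub0r.
by move/oppr_inj.
Qed.

Let d3E : P * dsum N 3 = dsum N 2 + hcomp 2 N.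
Proof. by have := dsumS N 1 => /(canRL (subrK _)) ->; ring. Qed.

Let d4E : P * dsum N 4 = dsum N 3 + hcomp 3 N.
Proof. by have := dsumS N 2 => /(canRL (subrK _)) ->; ring. Qed.

Let d5E : P * dsum N 5 = dsum N 4 + hcomp 4 N.
Proof. by have := dsumS N 3 => /(canRL (subrK _)) ->; ring. Qed.

Lemma mprod_Zloc k : mprod P k \in Zloc N.+1.
Proof. by rewrite mprod_bin rpredM ?rpred_nat ?rpred_sign. Qed.

Lemma dsum_mod m : dsum N m == hsum m N - P * msum 1 m mod 2.
Proof.
rewrite /dsum /msum /hsum mulr_sumr -!sumrB; apply: rpred_sum => k _.
rewrite -/(hsum 1 k); have lt_k := ltn_ord k.
have -> : mprod P k * recip k ^+ m
    - (recip k ^+ m - P * (hsum 1 k * recip k ^+ m)) =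
  (mprod P k - (1 - P * hsum 1 k)) * recip k ^+ m by ring.
by apply: pideal_mulr; [|apply/mprod_mod/ltnW|apply/rpredX/uZ].
Qed.

(** In the power-sum form of h_m every term but H_m contains H_1 or H_2^2, so m h_m and H_m agree to
    high order for m = 2, 3, 4. *)
Lemma hcomp2_mod : 2 * hcomp 2 N == H2 mod 4.
Proof.
have -> : 2 * hcomp 2 N - H2 = H1 * H1 by rewrite hcomp2E; ring.
by apply: (pidealM _ p_pr wolstenholme wolstenholme).
Qed.

Lemma hcomp3_mod : 3 * hcomp 3 N == H3 mod 3.
Proof.
rewrite -(pideal_natMK 2) //.
have -> : 2 * (3 * hcomp 3 N - H3) = H1 * (H1 * H1 + 3 * H2).
  by transitivity (6 * hcomp 3 N - 2 * H3); [|rewrite hcomp3E]; ring.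
apply: (pidealM _ p_pr wolstenholme (n := 1)) => //; apply: rpredD.
  by apply: pideal_mulr; rewrite ?hsum_small ?HZ.
by rewrite pideal_natMK ?hsum_small.
Qed.

Lemma hcomp4_mod : 4 * hcomp 4 N == H4 mod 2.
Proof.
rewrite -(pideal_natMK 2) // -(pideal_natMK 3) //.
have -> : 3 * (2 * (4 * hcomp 4 N - H4)) =
  H1 * (H1 ^+ 3 + 6 * H1 * H2 + 8 * H3) + 3 * (H2 * H2).
  by transitivity (24 * hcomp 4 N - 6 * H4); [|rewrite hcomp4E]; ring.
apply: rpredD.
  apply: pideal_mulr => //; first exact: wolstenholme.
  by rewrite !rpredD ?rpredM ?rpredX ?rpred_nat ?HZ.
by rewrite pideal_natMK // (pidealM _ p_pr (m := 1) (n := 1)) ?hsum_small.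
Qed.

Let d5I : dsum N 5 \in pideal N.+1 1.
Proof.
have -> : dsum N 5 = (dsum N 5 - (H5 - P * msum 1 5)) + H5 - P * msum 1 5 by ring.
apply: rpredB; first apply: rpredD.
- by apply: (@pideal_le _ p_pr _ 2) => //; apply: dsum_mod.
- exact: hsum_small.
by apply: pideal_mulr; rewrite ?pideal_p ?msum_Zloc.
Qed.

(** D_4 is computed twice modulo p^2: as -h_4, that is -H_4/4, because p divides D_5, and as H_4 - p
    B from the expansion of [mprod]. *)
Lemma H4_mod : 5 * H4 == 4 * P * B mod 2.
Proof.
have -> : 5 * H4 - 4 * P * B = P * (4 * dsum N 5) - (4 * hcomp 4 N - H4)
  - 4 * (dsum N 4 - (H4 - P * msum 1 4)) + P * (4 * (msum 1 4 - B)).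
  have -> : P * (4 * dsum N 5) = 4 * (P * dsum N 5) by ring.
  by rewrite d5E; ring.
apply: rpredD; first apply: rpredB; first apply: rpredB.
- by apply: (pideal_pXM _ p_pr 1 1); rewrite pideal_natMK.
- exact: hcomp4_mod.
- by rewrite pideal_natMK //; apply: dsum_mod.
by apply: (pideal_pXM _ p_pr 1 1); rewrite pideal_natMK ?msum14.
Qed.

Let kI k m x : x \in pideal N.+1 m -> k%:R * x \in pideal N.+1 m.
Proof. by apply: pideal_mull; rewrite ?rpred_nat. Qed.

(** Chaining the relations gives H_1 + p h_2 + p^2 h_3 + p^3 h_4 = p^4 D_5. With h_m replaced by
    H_m/m this is a second relation beside [wolstenholme_rev]; eliminating H_3 leaves p H_2 + 2 H_1
    in terms of p^3 H_4, known from [H4_mod]. *)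
Lemma H2_mod : 5 * (P * H2 + 2 * H1) == 2 * P ^+ 4 * B mod 5.
Proof.
rewrite -(pideal_natMK 2) //.
have L : H1 + P * hcomp 2 N + P ^+ 2 * hcomp 3 N + P ^+ 3 * hcomp 4 N = P ^+ 4 * dsum N 5.
  have -> : P ^+ 4 * dsum N 5 = P ^+ 3 * (P * dsum N 5) by ring.
  rewrite d5E mulrDr.
  have -> : P ^+ 3 * dsum N 4 = P ^+ 2 * (P * dsum N 4) by ring.
  rewrite d4E mulrDr.
  have -> : P ^+ 2 * dsum N 3 = P * (P * dsum N 3) by ring.
  by rewrite d3E mulrDr d2E.
(* The weights 60 and 20 cancel H_3 and clear the denominators 2, 3 and 4 of the h_m. *)
have -> : 2 * (5 * (P * H2 + 2 * H1) - 2 * P ^+ 4 * B) =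
  60 * (P ^+ 4 * dsum N 5)
  - 20 * (2 * H1 + P * H2 + P ^+ 2 * H3 + P ^+ 3 * H4)
  - P * (30 * (2 * hcomp 2 N - H2)) - P ^+ 2 * (20 * (3 * hcomp 3 N - H3))
  - P ^+ 3 * (15 * (4 * hcomp 4 N - H4)) + P ^+ 3 * (5 * H4 - 4 * P * B).
  by rewrite -L; ring.
apply: rpredD; first (apply: rpredB; first (apply: rpredB;
  first (apply: rpredB; first apply: rpredB))).
- by apply: kI; apply: (pideal_pXM _ p_pr 4 1).
- by apply/kI/wolstenholme_rev.
- by apply: (pideal_pXM _ p_pr 1 4); apply/kI/hcomp2_mod.
- by apply: (pideal_pXM _ p_pr 2 3); apply/kI/hcomp3_mod.
- by apply: (pideal_pXM _ p_pr 3 2); apply/kI/hcomp4_mod.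
by apply: (pideal_pXM _ p_pr 3 2); apply: H4_mod.
Qed.

(** * The sums T_m *)

Definition tsum n m := \sum_(k < n) mprod P k * cprod k * recip k ^+ m.

(** Telescopes a_k by means of a_(k+1) / a_k = 1 - p u_k - p^2 u_k^2 + p^3 u_k^3. *)
Lemma tsum1E n :
  mprod P n * cprod n - 1 = - P * tsum n 1 - P ^+ 2 * tsum n 2 + P ^+ 3 * tsum n 3.
Proof.
elim: n => [|n IHn].
  by rewrite /tsum /cprod /mprod !big_ord0; ring.
rewrite /tsum !big_ord_recr /= -!/(tsum _ _) mprodS cprodS.
have -> : mprod P n * (1 - P * recip n) * (cprod n * (1 - P ^+ 2 * recip n ^+ 2)) - 1 =
  (mprod P n * cprod n - 1) + mprod P n * cprod n *
    (- P * recip n - P ^+ 2 * recip n ^+ 2 + P ^+ 3 * recip n ^+ 3) by ring.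
by rewrite IHn; ring.
Qed.

(* Telescopes [k a_k]. *)
Lemma tsum0E n :
  n.+1%:R * (mprod P n * cprod n) - 1 =
  (1 - P) * tsum n 0 - (P + P ^+ 2) * tsum n 1 - (P ^+ 2 - P ^+ 3) * tsum n 2
    + P ^+ 3 * tsum n 3.
Proof.
elim: n => [|n IHn].
  by rewrite /tsum /cprod /mprod !big_ord0; ring.
rewrite /tsum !big_ord_recr /= -!/(tsum _ _) mprodS cprodS.
have -> : n.+2%:R * (mprod P n * (1 - P * recip n)
    * (cprod n * (1 - P ^+ 2 * recip n ^+ 2))) - 1 =
  (n.+1%:R * (mprod P n * cprod n) - 1) + mprod P n * cprod n *
    ((1 - P) - (P + P ^+ 2) * recip n - (P ^+ 2 - P ^+ 3) * recip n ^+ 2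
      + P ^+ 3 * recip n ^+ 3).
  have n0 : n.+1%:R != 0 :> rat by rewrite pnatr_eq0.
  by rewrite -[n.+2%:R]natr1 /recip; field; rewrite nat1r.
by rewrite IHn; ring.
Qed.

Let mprodN : mprod P N = 1.
Proof. by rewrite mprod_bin binn mulr1 -signr_odd (negbTE oddN). Qed.

Lemma msum22E : 2 * msum 2 2 = H2 ^+ 2 - H4.
Proof.
rewrite /msum; elim: N => [|n IHn]; first by rewrite !hsum0 big_ord0; ring.
by rewrite big_ord_recr mulrDr IHn !hsumS /=; ring.
Qed.

(** The constant 9/10 is 2/5 + 1/2: [msum 2 2] is -H_4/2, that is -(2/5) p B, modulo p^2, and [wsum]
    is B/2 modulo p. *)
Lemma tsum2_mod : 10 * (P * tsum N 2) == 10 * H1 + 9 * P ^+ 4 * B mod 5.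
Proof.
have tI : tsum N 2 - (dsum N 2 - P ^+ 2 * msum 2 2 + P ^+ 3 * wsum) \in pideal N.+1 4.
  rewrite /tsum /dsum /msum /wsum !mulr_sumr -!(sumrB, big_split) /=.
  apply: rpred_sum => k _; have lt_k := ltn_ord k.
  have -> : mprod P k * cprod k * recip k ^+ 2 - (mprod P k * recip k ^+ 2
      - P ^+ 2 * (hsum 2 k * recip k ^+ 2)
      + P ^+ 3 * (hsum 1 k * hsum 2 k * recip k ^+ 2)) =
    (cprod k - (1 - P ^+ 2 * hsum 2 k)) * (mprod P k * recip k ^+ 2)
    - P ^+ 2 * ((mprod P k - (1 - P * hsum 1 k)) * (hsum 2 k * recip k ^+ 2)) by ring.
  have u2Z : recip k ^+ 2 \in Zloc N.+1 by apply/rpredX/uZ.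
  apply: rpredB.
    apply: pideal_mulr => //; first exact/cprod_mod4/ltnW.
    by apply: rpredM => //; apply: mprod_Zloc.
  apply: (pideal_pXM _ p_pr 2 2); apply: pideal_mulr => //.
    exact/mprod_mod/ltnW.
  by apply: rpredM => //; apply/HZ/ltnW.
have -> : 10 * (P * tsum N 2) - (10 * H1 + 9 * P ^+ 4 * B) =
  P * (10 * (tsum N 2 - (dsum N 2 - P ^+ 2 * msum 2 2 + P ^+ 3 * wsum)))
  - P ^+ 3 * (5 * (H2 * H2)) + P ^+ 3 * (5 * H4 - 4 * P * B)
  + P ^+ 4 * (5 * (2 * wsum - B)).
  have -> : H2 * H2 = 2 * msum 2 2 + H4 by rewrite msum22E; ring.
  by rewrite -d2E; ring.
apply: rpredD; first (apply: rpredD; first apply: rpredB).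
- by apply: (pideal_pXM _ p_pr 1 4); apply: kI.
- apply: (pideal_pXM _ p_pr 3 2); apply: kI.
  by apply: (pidealM _ p_pr (m := 1) (n := 1)); apply: hsum_small.
- by apply: (pideal_pXM _ p_pr 3 2); apply: H4_mod.
by apply: (pideal_pXM _ p_pr 4 1); apply/kI/wsum_B.
Qed.

(** Exactly, p^2 D_3 = H_1 + p h_2, and the correction by [msum 2 3] contributes 2 p^4 B. The term
    h_2 is reduced to H_1 only later, through H_2. *)
Lemma tsum3_mod : P ^+ 2 * tsum N 3 == H1 + P * hcomp 2 N + 2 * P ^+ 4 * B mod 5.
Proof.
have tI : tsum N 3 - (dsum N 3 - P ^+ 2 * msum 2 3) \in pideal N.+1 3.
  rewrite /tsum /dsum /msum !mulr_sumr -!sumrB /=.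
  apply: rpred_sum => k _; have lt_k := ltn_ord k.
  have -> : mprod P k * cprod k * recip k ^+ 3 - (mprod P k * recip k ^+ 3
      - P ^+ 2 * (hsum 2 k * recip k ^+ 3)) =
    (cprod k - (1 - P ^+ 2 * hsum 2 k)) * (mprod P k * recip k ^+ 3)
    - P ^+ 2 * ((mprod P k - (1 - P * hsum 1 k)) * (hsum 2 k * recip k ^+ 3)
                - P * (hsum 1 k * hsum 2 k * recip k ^+ 3)) by ring.
  have u3Z : recip k ^+ 3 \in Zloc N.+1 by apply/rpredX/uZ.
  apply: rpredB.
    apply: (@pideal_le _ p_pr _ 4) => //.
    apply: pideal_mulr => //; first exact/cprod_mod4/ltnW.
    by apply: rpredM => //; apply: mprod_Zloc.
  apply: (pideal_pXM _ p_pr 2 1); apply: rpredB; apply: pideal_mulr => //.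
  - by apply: (@pideal_le _ p_pr _ 2) => //; apply/mprod_mod/ltnW.
  - by apply: rpredM => //; apply/HZ/ltnW.
  - exact: pideal_p.
  by apply: rpredM => //; apply: rpredM; apply/HZ/ltnW.
have -> : P ^+ 2 * tsum N 3 - (H1 + P * hcomp 2 N + 2 * P ^+ 4 * B) =
  P ^+ 2 * (tsum N 3 - (dsum N 3 - P ^+ 2 * msum 2 3))
  - P ^+ 4 * (msum 2 3 - - 2 * B).
  have -> : hcomp 2 N = P * dsum N 3 - dsum N 2 by rewrite d3E; ring.
  by rewrite -d2E; ring.
apply: rpredB; first exact: (pideal_pXM _ p_pr 2 3).
by apply: (pideal_pXM _ p_pr 4 1); apply: msum23.
Qed.

(** Modulo p^6, -p^2 H_2 gives 2 p H_1 - (2/5) p^5 B and -p^4 H_4/2 gives another -(2/5) p^5 B;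
    H_2^2 is divisible by p^2. *)
Lemma cprodN_mod : 10 * (cprod N - 1) == 20 * P * H1 - 8 * P ^+ 5 * B mod 6.
Proof.
have -> : 10 * (cprod N - 1) - (20 * P * H1 - 8 * P ^+ 5 * B) =
  10 * (cprod N - (1 - P ^+ 2 * H2 + P ^+ 4 * (2^-1 * (H2 ^+ 2 - H4))))
  + P ^+ 4 * (5 * (H2 * H2))
  - P * (2 * (5 * (P * H2 + 2 * H1) - 2 * P ^+ 4 * B))
  - P ^+ 4 * (5 * H4 - 4 * P * B) by field.
apply: rpredB; first (apply: rpredB; first apply: rpredD).
- exact/kI/cprod_mod6.
- apply: (pideal_pXM _ p_pr 4 2); apply: kI.
  by apply: (pidealM _ p_pr (m := 1) (n := 1)); apply: hsum_small.
- by apply: (pideal_pXM _ p_pr 1 5); apply/kI/H2_mod.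
by apply: (pideal_pXM _ p_pr 4 2); apply: H4_mod.
Qed.

(** Solves [tsum1E] for p T_1, hence works modulo p^6. The term p^2 h_2 coming from T_3 is replaced
    by p^2 H_2/2, that is -p H_1 + p^5 B/5; thus 21/10 = 2 - 9/10 + 4/5 + 1/5. *)
Lemma tsum1_mod : 10 * tsum N 1 == - 30 * H1 + 21 * P ^+ 4 * B mod 5.
Proof.
rewrite -(pideal_pXMK _ p_pr 1).
have -> : P ^+ 1 * (10 * tsum N 1 - (- 30 * H1 + 21 * P ^+ 4 * B)) =
  P * (10 * (P ^+ 2 * tsum N 3 - (H1 + P * hcomp 2 N + 2 * P ^+ 4 * B)))
  - P * (10 * (P * tsum N 2) - (10 * H1 + 9 * P ^+ 4 * B))
  - (10 * (cprod N - 1) - (20 * P * H1 - 8 * P ^+ 5 * B))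
  + P ^+ 2 * (5 * (2 * hcomp 2 N - H2))
  + P * (5 * (P * H2 + 2 * H1) - 2 * P ^+ 4 * B).
  by have := tsum1E N; rewrite mprodN mul1r => ->; ring.
apply: rpredD; first (apply: rpredD; first (apply: rpredB; first apply: rpredB)).
- by apply: (pideal_pXM _ p_pr 1 5); apply/kI/tsum3_mod.
- by apply: (pideal_pXM _ p_pr 1 5); apply/tsum2_mod.
- exact: cprodN_mod.
- by apply: (pideal_pXM _ p_pr 2 4); apply/kI/hcomp2_mod.
by apply: (pideal_pXM _ p_pr 1 5); apply: H2_mod.
Qed.

(** From [tsum0E] comes (1-p) T_0, with H_1 multiplied by -2p(1+p). In the quotient by 1-p, as a
    power series in p, only the terms up to p^3 matter since p^2 divides H_1. *)
Lemma tsum0_mod :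
  5 * tsum N 0 == - 5 - 5 * (4 * P ^+ 3 + 4 * P ^+ 2 + 2 * P) * H1 + 4 * P ^+ 5 * B mod 6.
Proof.
set Y := _ - _.
have N0 : N%:R != 0 :> rat by rewrite pnatr_eq0; have := p_gt5; lia.
(* Here 1 - p = -N is a unit. *)
have -> : Y = N%:R^-1 * - ((1 - P) * Y).
  by rewrite -mulNr -natr1; field.
apply: pideal_mull => //; first by apply: Zloc_invn => //; have := p_gt5; lia.
rewrite rpredN -(pideal_natMK 2) //.
have -> : 2 * ((1 - P) * Y) =
  P * (10 * (cprod N - 1) - (20 * P * H1 - 8 * P ^+ 5 * B))
  + P * ((1 + P) * (10 * tsum N 1 - (- 30 * H1 + 21 * P ^+ 4 * B)))
  + P * ((1 - P) * (10 * (P * tsum N 2) - (10 * H1 + 9 * P ^+ 4 * B)))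
  - P * (10 * (P ^+ 2 * tsum N 3 - (H1 + P * hcomp 2 N + 2 * P ^+ 4 * B)))
  - P ^+ 2 * (5 * (2 * hcomp 2 N - H2))
  - P * (5 * (P * H2 + 2 * H1) - 2 * P ^+ 4 * B)
  - P ^+ 4 * (40 * H1) + P ^+ 6 * (12 * B).
  have := tsum0E N; rewrite mprodN mul1r => /(canRL (subrK _)) E.
  have -> : 10 * (cprod N - 1) = 10 * cprod N - 10 by ring.
  have -> : P * (10 * cprod N - 10 - (20 * P * H1 - 8 * P ^+ 5 * B)) =
    10 * (P * cprod N) - 10 * P - P * (20 * P * H1 - 8 * P ^+ 5 * B) by ring.
  by rewrite E /Y; ring.
have P1Z : 1 + P \in Zloc N.+1 by rewrite nat1r rpred_nat.
have P1Z' : 1 - P \in Zloc N.+1 by rewrite rpredB ?rpred1 ?rpred_nat.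
apply: rpredD; first (apply: rpredB; first (apply: rpredB; first (apply: rpredB;
  first (apply: rpredB; first (apply: rpredD; first apply: rpredD))))).
- apply: (@pideal_le _ p_pr _ 7) => //.
  by apply: (pideal_pXM _ p_pr 1 6); apply: cprodN_mod.
- by apply: (pideal_pXM _ p_pr 1 5); apply: pideal_mull => //; apply: tsum1_mod.
- by apply: (pideal_pXM _ p_pr 1 5); apply: pideal_mull => //; apply: tsum2_mod.
- by apply: (pideal_pXM _ p_pr 1 5); apply/kI/tsum3_mod.
- by apply: (pideal_pXM _ p_pr 2 4); apply/kI/hcomp2_mod.
- by apply: (pideal_pXM _ p_pr 1 5); apply: H2_mod.
- by apply: (pideal_pXM _ p_pr 4 2); apply/kI/wolstenholme.
apply: pideal_mulr => //; first exact: pideal_exp.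
by apply: rpredM; [apply: rpred_nat | apply: B_Zloc].
Qed.

(** * The three binomial sums in terms of the T_m *)

Lemma sum_binE (f : nat -> rat) :
  \sum_(1 <= k < N.+1) 'C(N.+1, k)%:R ^+ 2 * 'C(N.+1 + k - 1, k - 1)%:R * f k =
  P ^+ 2 * \sum_(k < N) mprod P k * cprod k * recip k ^+ 2 * f k.+1.
Proof.
rewrite big_add1 big_mkord mulr_sumr; apply: eq_bigr => k _ /=.
have /(congr1 (fun k => k%:R : rat)) := mul_bin_diag N.+1 k.
rewrite !natrM /= => E.
have -> : 'C(N.+1, k.+1)%:R = P * 'C(N, k)%:R * recip k :> rat.
  by rewrite E mulrAC mulr_recip mul1r.
rewrite subSS subn0 addnS subSS subn0 -mprod_binN /cprod.
(* The sign relating 'C(N, k) to [mprod] disappears because the binomial is squared. *)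
have -> : 'C(N, k)%:R = (-1) ^+ k * mprod P k :> rat by rewrite mprod_bin signrMK.
have := sqrr_sign rat k; set sg := (-1) ^+ k => S.
have -> : (P * (sg * mprod P k) * recip k) ^+ 2 =
  sg ^+ 2 * (P * mprod P k * recip k) ^+ 2 by ring.
by rewrite S; ring.
Qed.

Lemma sum_bin_pow i : (i <= 2)%N ->
  \sum_(1 <= k < N.+1) 'C(N.+1, k)%:R ^+ 2 * 'C(N.+1 + k - 1, k - 1)%:R * k%:R ^+ i =
  P ^+ 2 * tsum N (2 - i).
Proof.
move=> i2; rewrite (sum_binE (fun k => k%:R ^+ i)); congr (_ * _).
apply: eq_bigr => k _; rewrite -{1}(subnK i2) exprD -!mulrA -exprMn.
by rewrite [recip k * _]mulrC mulr_recip expr1n mulr1.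
Qed.

Lemma harmonicE : harmonic (N.+1 - 1) = H1.
Proof. by rewrite /harmonic subn1 big_add1 big_mkord. Qed.

End Congruences.

Theorem theorem4p1 (p : nat) (p_prime : prime p) (p_gt5 : (5 < p)%N) :
  [/\ eqmodq p 6
        (\sum_(1 <= k < p) 'C(p, k)%:R ^+ 2 * 'C(p + k - 1, k - 1)%:R)
        (p%:R * harmonic (p - 1) + 9 / 10 * p%:R ^+ 5 * bernoulli (p - 5)),
      eqmodq p 7
        (\sum_(1 <= k < p) 'C(p, k)%:R ^+ 2 * 'C(p + k - 1, k - 1)%:R * k%:R)
        (- 3 * p%:R ^+ 2 * harmonic (p - 1)
           + 21 / 10 * p%:R ^+ 6 * bernoulli (p - 5))
    & eqmodq p 8
        (\sum_(1 <= k < p)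
           'C(p, k)%:R ^+ 2 * 'C(p + k - 1, k - 1)%:R * k%:R ^+ 2)
        (- p%:R ^+ 2
           - (4 * p%:R ^+ 5 + 4 * p%:R ^+ 4 + 2 * p%:R ^+ 3) * harmonic (p - 1)
           + 4 / 5 * p%:R ^+ 7 * bernoulli (p - 5))].
Proof.
case: p p_prime p_gt5 => // N p_pr p_gt5; rewrite harmonicE.
have H1Z : hsum 1 N \in Zloc N.+1 by apply: hsum_Zloc.
have BZ : bernoulli (N.+1 - 5) \in Zloc N.+1 by apply: B_Zloc.
have i5Z : 5^-1 \in Zloc N.+1 by apply: Zloc_inv.
have i10Z : 10^-1 \in Zloc N.+1.
  (* As 10 may exceed p, it is inverted factor by factor. *)
  by rewrite (_ : 10 = 2 * 5) // invfM rpredM // Zloc_inv.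
have natMK k m x : (0 < k <= 5)%N -> k%:R * x \in pideal N.+1 m -> x \in pideal N.+1 m.
  by move=> k5; rewrite pideal_natMK.
have PZ m : N.+1%:R ^+ m \in Zloc N.+1 by apply/rpredX/rpred_nat.
have divZ m k d : d%:R^-1 \in Zloc N.+1 ->
    m%:R / d%:R * N.+1%:R ^+ k * bernoulli (N.+1 - 5) \in Zloc N.+1.
  by move=> dZ; do 3 (apply: rpredM => //); apply: rpred_nat.
split; apply: (eqmodqP _ p_pr).
- by apply: rpredD; [apply: rpredM => //; apply: (PZ 1) | apply: divZ].
- have := sum_bin_pow N 0 isT; under eq_bigr do rewrite expr0 mulr1.
  (* Since 2 and 5 are units, multiplying by 10 to clear the denominator loses nothing. *)
  move=> ->; apply: (natMK 2) => //; apply: (natMK 5) => //.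
  set x := (X in X \in _).
  have -> : x = N.+1%:R * (10 * (N.+1%:R * tsum N N 2)
     - (10 * hsum 1 N + 9 * N.+1%:R ^+ 4 * bernoulli (N.+1 - 5))) by rewrite /x; field.
  by apply: (pideal_pXM _ p_pr 1 5); apply: tsum2_mod.
- apply: rpredD; last exact: divZ.
  apply: rpredM => //; apply: rpredM => //.
  by rewrite rpredN; apply: rpred_nat.
- rewrite (sum_bin_pow N 1) //; apply: (natMK 2) => //; apply: (natMK 5) => //.
  set x := (X in X \in _).
  have -> : x = N.+1%:R ^+ 2 * (10 * tsum N N 1
     - (- 30 * hsum 1 N + 21 * N.+1%:R ^+ 4 * bernoulli (N.+1 - 5))) by rewrite /x; field.
  by apply: (pideal_pXM _ p_pr 2 5); apply: tsum1_mod.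
- apply: rpredD; last exact: divZ.
  apply: rpredB; first by rewrite rpredN; apply: (PZ 2).
  apply: rpredM => //; apply: rpredD; first apply: rpredD;
    by apply: rpredM; [apply: rpred_nat | apply: PZ].
rewrite (sum_bin_pow N 2) //; apply: (natMK 5) => //.
set x := (X in X \in _).
have -> : x = N.+1%:R ^+ 2 * (5 * tsum N N 0
   - (- 5 - 5 * (4 * N.+1%:R ^+ 3 + 4 * N.+1%:R ^+ 2 + 2 * N.+1%:R) * hsum 1 N
      + 4 * N.+1%:R ^+ 5 * bernoulli (N.+1 - 5))) by rewrite /x; field.
by apply: (pideal_pXM _ p_pr 2 6); apply: tsum0_mod.
Qed.
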